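(* Let $n\ge 1$ and let $\Delta=[-1,1]^n$ be endowed with Lebesgue measure $\lambda$. There is a constant $C>0$ depending only on $n$ with the following property. Let $d\ge 1$, let $p(X)=\sum_{|\beta|\le d}p_\beta X^\beta\in\mathbb{R}[X_1,\dots,X_n]$ be a non-constant polynomial, let $\alpha\in\mathbb{N}^n$ be an admissible multi-index with respect to $p$, and let $\chi$ be the characteristic function of the set $\{x\in\Delta : p(x)\ge 0\}$. Fix a norm $\|\cdot\|$ on the finite-dimensional real vector space of families $(s_\beta)_{|\beta|\le d}$. Then there is a constant $K$, depending (besides the chosen norm) only on $p$, $\alpha$ and $n$, such that $$\|\chi-g\|_1\le K\,\|s(\chi)-s(g)\|^{\frac{1}{|\alpha|+1}}$$ for every measurable function $g:\Delta\to[0,1]$ satisfying $\|\chi-g\|_1\le \frac{|p_\alpha|^{1/|\alpha|}}{4d}\,C$.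
   Context: For $\beta=(\beta_1,\dots,\beta_n)\in\mathbb{N}^n$ (with $0\in\mathbb{N}$), $x^\beta=x_1^{\beta_1}\cdots x_n^{\beta_n}$ and $|\beta|=\beta_1+\dots+\beta_n$. For a bounded measurable function $h$ on $\Delta$, $s_\beta(h)=\int_\Delta x^\beta h\,d\lambda$, $s(h)=(s_\beta(h))_{|\beta|\le d}$, and $\|h\|_1=\int_\Delta|h|\,d\lambda$. A multi-index $\alpha\in\mathbb{N}^n$ is called admissible with respect to $p=\sum_\beta p_\beta X^\beta$ if $p_\alpha\ne0$ and there exists a permutation $(\sigma(1),\dots,\sigma(n))$ of $(1,\dots,n)$ such that for every $\beta\neq\alpha$ with $p_\beta\neq 0$, either $\alpha_{\sigma(1)}>\beta_{\sigma(1)}$, or there exists an index $j\ge2$ with $\alpha_{\sigma(j)}>\beta_{\sigma(j)}$ and $\alpha_{\sigma(k)}=\beta_{\sigma(k)}$ for $1\le k\le j-1$. *)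

(* Defs.v *)
From HB Require Import structures.
From mathcomp Require Import all_boot all_order all_algebra all_fingroup.
(* The notations of mpoly clash with those of the analysis library, so that
   'X_{1..n}, 'X_{1..n < b}, {mpoly R[n]}, p@_m, p.@[v] and c%:MP are written
   multinom n, bmultinom n b, mpoly n R, mcoeff m p, meval v p and mpolyC n c.
   Both libraries define measure and isMeasure: mpoly has to come first. *)
From mathcomp Require Import -(notations) mpoly.
From mathcomp Require Import all_classical all_reals all_analysis.

Set Implicit Arguments.
Unset Strict Implicit.
Unset Printing Implicit Defensive.

Import Order.TTheory GRing.Theory Num.Theory.
Import numFieldNormedType.Exports.

Local Open Scope classical_set_scope.
Local Open Scope ring_scope.

Section lebesgue_on_tuples.
Context {R : realType}.
Local Notation bR := (measurableTypeR R).

Definition tcons n (u : bR * n.-tuple bR) : n.+1.-tuple bR :=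
  [tuple of u.1 :: u.2].

Lemma measurable_tcons n : measurable_fun setT (@tcons n).
Proof. exact: measurable_cons. Qed.

(* The n-fold product of the Lebesgue measure of R, on the Borel sets of R^n. *)
Fixpoint borel_lebesgue n : set (n.-tuple bR) -> \bar R :=
  if n is m.+1
  then pushforward (@lebesgue_measure R \x @borel_lebesgue m)%E (@tcons m)
  else dirac [tuple].

Section tcons_product.
Variables (n : nat) (m1 : {sigma_finite_measure set bR -> \bar R}).
Variable m2 : {sigma_finite_measure set (n.-tuple bR) -> \bar R}.

Definition tcons_product := pushforward (m1 \x m2)%E (@tcons n).

Let nu : {measure set (n.+1.-tuple bR) -> \bar R} :=
  measure_function_pushforward__canonical__measure_function_Measure
    (m1 \x m2)%E (@measurable_tcons n).

HB.instance Definition _ := isMeasure.Build _ _ _ tcons_product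
  (measure0 nu) (measure_ge0 nu) (@measure_semi_sigma_additive _ _ _ nu).

Let tcons_product_sigma_finite : sigma_finite setT tcons_product.
Proof.
have /sigma_finiteP[F [TF ndF Foo]] := sigma_finiteT m1.
have /sigma_finiteP[G [TG ndG Goo]] := sigma_finiteT m2.
pose g (t : n.+1.-tuple bR) := (thead t, [tuple of behead t]).
have mg : measurable_fun setT g.
  apply/measurable_fun_pairP; split; last exact: measurable_behead.
  exact: (measurable_tnth (T := bR) ord0).
exists (fun k => g @^-1` (F k `*` G k)).
  rewrite -preimage_bigcup; apply/esym; rewrite -subTset => t _ /=.
  have [i _ Fi] : (\bigcup_i F i) (g t).1 by rewrite -TF.
  have [j _ Gj] : (\bigcup_i G i) (g t).2 by rewrite -TG.
  exists (maxn i j) => //; split.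
    by move: Fi; exact/subsetPset/ndF/leq_maxl.
  by move: Gj; exact/subsetPset/ndG/leq_maxr.
move=> k; have [mF Fk] := Foo k; have [mG Gk] := Goo k.
have mFG : measurable (F k `*` G k) by exact: measurableX.
split; first by rewrite -[X in measurable X]setTI; exact: mg.
rewrite /tcons_product /pushforward -comp_preimage.
rewrite (_ : g \o _ = id) ?preimage_id.
  by rewrite product_measure1E// lte_mul_pinfty// ge0_fin_numE.
by apply/funext => -[x t] /=; rewrite /g theadE; congr pair; apply/val_inj.
Qed.

HB.instance Definition _ := Measure_isSigmaFinite.Build _ _ _ tcons_product
  tcons_product_sigma_finite.

End tcons_product.

Lemma borel_lebesgue_sigma_finite_measure n :
  exists mu : {sigma_finite_measure set (n.-tuple bR) -> \bar R},
    mu = @borel_lebesgue n :> (set (n.-tuple bR) -> \bar R).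
Proof.
elim: n => [|n [mu mu_eq]]; first by exists (dirac [tuple]).
by exists (tcons_product (@lebesgue_measure R) mu); rewrite /= -mu_eq.
Qed.

Section borel_lebesgue_measure.
Variable n : nat.
Local Open Scope ereal_scope.

Let borel_lebesgue0 : @borel_lebesgue n set0 = 0.
Proof. by have [mu <-] := borel_lebesgue_sigma_finite_measure n. Qed.

Let borel_lebesgue_ge0 A : 0 <= @borel_lebesgue n A.
Proof. by have [mu <-] := borel_lebesgue_sigma_finite_measure n. Qed.

Let borel_lebesgue_sigma_additive : semi_sigma_additive (@borel_lebesgue n).
Proof.
have [mu <-] := borel_lebesgue_sigma_finite_measure n.
exact: measure_semi_sigma_additive.
Qed.

HB.instance Definition _ := isMeasure.Build _ _ _ (@borel_lebesgue n)
  borel_lebesgue0 borel_lebesgue_ge0 borel_lebesgue_sigma_additive.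

Let borel_lebesgue_sigma_finite : sigma_finite setT (@borel_lebesgue n).
Proof.
have [mu <-] := borel_lebesgue_sigma_finite_measure n.
exact: sigma_finiteT.
Qed.

HB.instance Definition _ := Measure_isSigmaFinite.Build _ _ _
  (@borel_lebesgue n) borel_lebesgue_sigma_finite.

End borel_lebesgue_measure.

(* R^n with the sigma-algebra of all Lebesgue measurable sets: the
   Caratheodory measurable sets of the outer measure of borel_lebesgue. *)
Definition lebesgue_type n : measurableType _ :=
  caratheodory_type (@borel_lebesgue n)^*%mu.

Definition lebesgue n : {measure set (lebesgue_type n) -> \bar R} :=
  @completed_measure_extension _ _ _ (@borel_lebesgue n).

End lebesgue_on_tuples.
Arguments borel_lebesgue R n : clear implicits.
Arguments lebesgue_type R n : clear implicits.
Arguments lebesgue R n : clear implicits.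

Definition cube (R : realType) n : set (n.-tuple R) :=
  [set x | forall i : 'I_n, -1 <= tnth x i <= 1].
Arguments cube R n : clear implicits.

Section moments.
Context {R : realType} {n : nat}.
Implicit Types (h : n.-tuple R -> R) (b : multinom n).

Definition monomial b (x : n.-tuple R) : R := \prod_(i < n) tnth x i ^+ b i.

Definition moment h b : R :=
  \int[lebesgue R n]_(x in cube R n) (monomial b x * h x).

(* bmultinom n d.+1 is the finite type of the multi-indices b with
   mdeg b < d.+1; R^o is R as a vector space over itself. *)
Definition moments (d : nat) h : {ffun bmultinom n d.+1 -> R^o} :=
  [ffun b : bmultinom n d.+1 => moment h b].

Definition l1norm h : R := \int[lebesgue R n]_(x in cube R n) `|h x|.

Definition nonneg_indicator (p : mpoly n R) : n.-tuple R -> R :=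
  \1_[set x : n.-tuple R | cube R n x /\ 0 <= meval (tnth x) p].

(* s 0, s 1, ... stand for sigma(1), sigma(2), ...; the case j = 0 is the case
   alpha_{sigma(1)} > beta_{sigma(1)}. *)
Definition admissible (alpha : multinom n) (p : mpoly n R) : Prop :=
  mcoeff alpha p != 0 /\
  exists s : {perm 'I_n}, forall beta : multinom n,
    beta != alpha -> mcoeff beta p != 0 ->
    exists j : 'I_n, (beta (s j) < alpha (s j))%N /\
      forall k : 'I_n, (k < j)%N -> alpha (s k) = beta (s k).

End moments.

Record is_norm (R : realType) (V : lmodType R) (N : V -> R) : Prop := IsNorm {
  is_norm_triangle : forall u v, N (u + v) <= N u + N v ;
  is_normZ : forall a u, N (a *: u) = `|a| * N u ;
  is_norm0_eq0 : forall u, N u = 0 -> u = 0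
}.

(* Main.v *)
Require Import Defs.
From mathcomp Require Import all_boot all_order all_algebra all_fingroup.
From mathcomp Require Import -(notations) mpoly.
From mathcomp Require Import all_classical all_reals all_analysis.
From mathcomp Require Import measurable_realfun.
From mathcomp Require Import -(notations) complex.
From mathcomp Require Import ring lra.

Set Implicit Arguments.
Unset Strict Implicit.
Unset Printing Implicit Defensive.

Import Order.TTheory GRing.Theory Num.Theory.
Import numFieldNormedType.Exports.

Local Open Scope classical_set_scope.
Local Open Scope ring_scope.

(** Put f = chi - g. It is nonnegative where p >= 0 and nonpositive elsewhere,
so p f = |p| |f| on the cube. The integral of p f is the linear combination,
with the coefficients of p, of the moments of chi minus those of g; all norms
being equivalent in finite dimension ([coord_le_is_norm]), it is at most
L ||s(chi) - s(g)|| for a constant L depending on p and the norm.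

Conversely that integral cannot be small if f is not, because p is small only
on a small set: [sublevel_meval] gives a constant A such that
  lambda {x in Delta : |p(x)| < |p_alpha| t ^ |alpha|} <= A t for all t > 0.
As |f| <= 1, discarding this set costs at most A t, hence
  |p_alpha| t ^ |alpha| (||f||_1 - A t) <= \int p f <= L ||s(chi) - s(g)||
([layer_le_Rintegral]), and the choice t = ||f||_1 / (2 A) gives the theorem.

The sublevel estimate eliminates the coordinates in the order s 0, s 1, ...
of the admissible permutation. Let q_j be the coefficient in p, seen as a
polynomial in x_{s 0}, ..., x_{s (j - 1)}, of the monomial whose exponents are
those of alpha ([partial_lead]). Then q_0 = p, the last q_j is the constant
p_alpha, and admissibility says that q_{j+1} is the leading coefficient of q_j
in the variable x_{s j}, in which q_j has degree a_j = alpha_{s j}. If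
|q_j| < |p_alpha| t ^ (a_j + b), then either |q_{j+1}| < |p_alpha| t ^ b, or
|q_j| < |q_{j+1}| t ^ a_j. The last inequality confines x_{s j} to a set of
length at most 2 a_j t: a univariate polynomial of degree a is bounded below by
its leading coefficient times the distances to the real parts of its complex
roots ([lead_coef_prod_dist_le]), one of which is then less than t. By Tonelli's
theorem the points of the second kind have measure at most 2 ^ n (2 a_j t)
([borel_lebesgue_le_lines]); adding up over j gives the estimate. *)

(** * Sublevel sets of univariate polynomials *)

(** Over the complex numbers P splits, and |y - z| >= |y - Re z| for real y. *)
Lemma lead_coef_prod_dist_le (R : rcfType) (P : {poly R}) :
  exists2 s : seq R, size s = (size P).-1 &
    forall y, `|lead_coef P| * \prod_(z <- s) `|y - z| <= `|P.[y]|.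
Proof.
have [-> | P0] := eqVneq P 0.
  by exists [::] => [|y]; rewrite ?size_poly0// big_nil lead_coef0 normr0 mul0r.
pose iota : {rmorphism R -> complex R} := real_complex R.
have [r rE] := closed_field_poly_normal (map_poly iota P).
exists [seq complex.Re z | z <- r] => [|y].
  rewrite size_map; apply/eqP; rewrite -eqSS.
  have /(congr1 (fun q : {poly _} => size q)) := rE.
  rewrite size_scale ?lead_coef_map ?fmorph_eq0 ?lead_coef_eq0//.
  by rewrite size_prod_XsubC size_map_poly => <-; rewrite prednK ?size_poly_gt0.
have normr_iota x : `|iota x| = iota `|x|.
  by rewrite normc_def /= expr0n addr0 sqrtr_sqr.
suff : iota (`|lead_coef P| *
    \prod_(z <- [seq complex.Re z | z <- r]) `|y - z|) <= iota `|P.[y]|.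
  by rewrite lecR.
rewrite big_map -normr_iota -horner_map [X in X.[_]]rE hornerZ horner_prod.
rewrite normrM normr_prod.
rewrite rmorphM rmorph_prod lead_coef_map normr_iota.
apply: ler_wpM2l; first by rewrite ler0c.
apply: ler_prod => z _; rewrite ler0c normr_ge0 /=.
rewrite !hornerE; apply: le_trans (normc_ge_Re _).
by case: z => a b /=; rewrite lexx.
Qed.

Section univariate.
Context (R : realType).
Local Notation leb := (@lebesgue_measure R).

(** If all the points of [lead_coef_prod_dist_le] were at distance at least t
from y, then |P.[y]| would be at least |lead_coef P| * t ^ deg P; so S lies in
a union of deg P intervals of length 2 t. *)
Lemma lebesgue_sublevel_poly_le (P : {poly R}) (t : R)
    (S : set (measurableTypeR R)) :
  measurable S -> 0 < t ->
  S `<=` [set y | `|P.[y]| < `|lead_coef P| * t ^+ (size P).-1] ->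
  (leb S <= (((size P).-1 * 2)%:R * t)%:E)%E.
Proof.
move=> mS t0 Ssub.
have [s sE sP] := lead_coef_prod_dist_le P.
have Scov : S `<=` \big[setU/set0]_(z <- s) `]z - t, z + t[%classic.
  move=> y /Ssub /= /(le_lt_trans (sP y)) Py.
  rewrite -bigcup_seq /=; apply: contrapT => ynot.
  move: Py; apply/negP; rewrite -leNgt ler_wpM2l //.
  have -> : t ^+ (size P).-1 = \prod_(z <- s) t.
    by rewrite big_const_seq count_predT iter_mulr_1 sE.
  rewrite big_seq_cond [leRHS]big_seq_cond; apply: ler_prod => z /andP[zs _].
  rewrite (ltW t0) /= leNgt; apply/negP => yz; apply: ynot; exists z => //=.
  by rewrite in_itv /= -ltr_distl.
have mI z : measurable (`]z - t, z + t[%classic : set (measurableTypeR R)).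
  exact: measurable_itv.
have mU (r : seq R) :
    measurable (\big[setU/set0]_(z <- r) `]z - t, z + t[%classic
      : set (measurableTypeR R)).
  exact: bigsetU_measurable.
apply: (@le_trans _ _ (leb (\big[setU/set0]_(z <- s) `]z - t, z + t[%classic))).
  by apply: le_measure; rewrite ?inE.
rewrite -sE; elim: s {sE sP Scov} => [|z s IHs].
  by rewrite big_nil measure0 mul0n mul0r.
rewrite big_cons; apply: (le_trans (@measureU2 _ _ R leb _ _ (mI z) (mU s))).
rewrite /= mulSn natrD mulrDl EFinD; apply: leeD => //.
rewrite lebesgue_measure_itv /= lte_fin ler_ltD ?gtrN// -EFinB lee_fin.
by rewrite opprB addrC addrA subrK mulr_natl mulr2n.
Qed.

End univariate.

(** * Sets with short slices in one direction *)

Section slice.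
Context (R : realType).
Local Notation bR := (measurableTypeR R).
Local Notation leb := (@lebesgue_measure R).

Definition set_coord n (x : n.-tuple R) (i : 'I_n) (y : R) : n.-tuple R :=
  [tuple if j == i then y else tnth x j | j < n].

Lemma set_coord_tcons0 n (x : n.+1.-tuple R) y :
  set_coord x ord0 y = tcons (y, [tuple of behead x]).
Proof.
apply: eq_from_tnth => j; rewrite tnth_mktuple.
case: (unliftP ord0 j) => [k ->|->] /=; last by rewrite (tnth_nth y).
by rewrite tnthS !(tnth_nth y) nth_behead.
Qed.

Lemma set_coord_tconsS n (x : n.-tuple R) (i : 'I_n) y z :
  set_coord (tcons (z, x)) (lift ord0 i) y = tcons (z, set_coord x i y).
Proof.
apply: eq_from_tnth => j; rewrite tnth_mktuple.
case: (unliftP ord0 j) => [k ->|->] /=; last by rewrite !tnth0.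
by rewrite (inj_eq (@lift_inj _ _)) !tnthS tnth_mktuple.
Qed.

Lemma measurable_set_coord n (x : n.-tuple R) (i : 'I_n) :
  measurable_fun [set: bR] (set_coord x i : bR -> n.-tuple bR).
Proof.
apply/measurable_fun_tnthP => j /=.
rewrite (_ : _ \o _ = fun y : bR => if j == i then y else tnth x j : bR).
  by case: (j == i).
by apply/funext => y /=; rewrite tnth_mktuple.
Qed.

Lemma measurable_tcons_preimage n (E : set (n.+1.-tuple bR)) :
  measurable E -> measurable (@tcons R n @^-1` E).
Proof.
by move=> mE; rewrite -[X in measurable X]setTI; exact: measurable_tcons.
Qed.

Lemma xsection_tcons n (E : set (n.+1.-tuple bR)) y :
  xsection (@tcons R n @^-1` E) y = [set u | E (tcons (y, u))].
Proof. by apply/funext => u; rewrite /xsection /= inE. Qed.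

Lemma ysection_tcons n (E : set (n.+1.-tuple bR)) u :
  ysection (@tcons R n @^-1` E) u = [set y | E (tcons (y, u))].
Proof. by apply/funext => y; rewrite /ysection /= inE. Qed.

Lemma borel_lebesgueS n (E : set (n.+1.-tuple bR)) :
  borel_lebesgue R n.+1 E =
  (\int[leb]_y borel_lebesgue R n [set u | E (tcons (y, u))])%E.
Proof.
rewrite /= /pushforward.
by apply: eq_integral => y _ /=; rewrite xsection_tcons.
Qed.

(** Tonelli's theorem for indicators: the iterated integral of the definition
may be computed in the other order. *)
Lemma borel_lebesgueS_rev n (E : set (n.+1.-tuple bR)) : measurable E ->
  borel_lebesgue R n.+1 E =
  (\int[borel_lebesgue R n]_u leb [set y | E (tcons (y, u))])%E.
Proof.
move=> mE; rewrite /= /pushforward.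
have -> := @product_measure_unique _ _ _ _ R leb (borel_lebesgue R n)
  (leb \x^ borel_lebesgue R n)%E.
- by apply: eq_integral => u _ /=; rewrite ysection_tcons.
- by move=> A B mA mB; exact: product_measure2E.
- exact: measurable_tcons_preimage.
Qed.

Lemma measurable_cube n : measurable (cube R n : set (n.-tuple bR)).
Proof.
rewrite (_ : cube R n = \big[setI/setT]_(i < n)
    ((@tnth n bR ^~ i) @^-1` `[-1, 1]%classic)).
  apply: bigsetI_measurable => i _; rewrite -[X in measurable X]setTI.
  exact: measurable_tnth.
rewrite -(@bigcap_seq _ _ (index_enum 'I_n)).
apply/seteqP; split=> x /= xP i; last first.
  by apply: (xP i); rewrite /= mem_index_enum.
by move=> _; rewrite /= in_itv /= xP.
Qed.

Lemma cube_tcons n y (u : n.-tuple R) :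
  cube R n.+1 (tcons (y, u)) <-> -1 <= y <= 1 /\ cube R n u.
Proof.
split=> [yu|[yP uP] i].
  split=> [|i]; first by have := yu ord0; rewrite tnth0.
  by have := yu (lift ord0 i); rewrite tnthS.
by case: (unliftP ord0 i) => [k ->|->]; rewrite ?tnthS ?tnth0.
Qed.

Lemma integral_le_cst_on d (T : measurableType d) (mu : {measure set T -> \bar R})
    (D : set T) (f : T -> \bar R) (M : \bar R) :
  measurable D -> measurable_fun setT f -> (forall x, 0 <= f x)%E ->
  (forall x, ~ D x -> f x = 0%E) -> (forall x, f x <= M)%E ->
  (\int[mu]_x f x <= M * mu D)%E.
Proof.
move=> mD mf f0 fD fM.
rewrite -integral_cst // [leRHS]integral_mkcond; apply: ge0_le_integral => //.
- by apply/(measurable_restrictT _ mD); exact: measurable_cst.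
- move=> x _; rewrite patchE; case: ifPn => // xD; rewrite fD //.
  by move/negP: xD; rewrite inE.
Qed.

Lemma measurable_tcons_section n (E : set (n.+1.-tuple bR)) y :
  measurable E -> measurable [set u : n.-tuple bR | E (tcons (y, u))].
Proof.
move=> mE; rewrite -[X in measurable X]setTI.
apply: (measurable_cons (f := fun=> y : bR) (g := id)) => //.
Qed.

Lemma lebesgue_segment : leb `[-1, 1]%classic = 2%:E.
Proof. by rewrite lebesgue_measure_itv /= lte_fin gtrN // -EFinB opprK. Qed.

Lemma borel_lebesgue_le_sections n (E : set (n.+1.-tuple bR)) (M : R) :
  measurable E -> E `<=` cube R n.+1 ->
  (forall y, borel_lebesgue R n [set u | E (tcons (y, u))] <= M%:E)%E ->
  (borel_lebesgue R n.+1 E <= (M * 2)%:E)%E.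
Proof.
move=> mE Ecube EM; rewrite borel_lebesgueS EFinM -lebesgue_segment.
apply: integral_le_cst_on => //.
- rewrite (_ : (fun y => _) =
      borel_lebesgue R n \o xsection (@tcons R n @^-1` E)).
    apply: (measurable_fun_xsection (borel_lebesgue R n)).
    exact: measurable_tcons_preimage.
  by apply/funext => y /=; rewrite xsection_tcons.
- move=> y yN; rewrite (_ : [set _ | _] = set0) ?measure0 //.
  apply/seteqP; split=> // u /Ecube /cube_tcons[y1 _].
  by apply: yN; rewrite /= in_itv.
Qed.

Lemma borel_lebesgue_cube_le n :
  (borel_lebesgue R n (cube R n) <= (2 ^+ n)%:E)%E.
Proof.
elim: n => [|n IHn]; first by rewrite /= diracE lee_fin expr0; case: (_ \in _).
rewrite exprSr; apply: borel_lebesgue_le_sections => // [|y].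
  exact: measurable_cube.
apply: le_trans IHn; apply: le_measure; rewrite ?inE.
- exact: (measurable_tcons_section y (@measurable_cube n.+1)).
- exact: measurable_cube.
- by move=> u /cube_tcons[].
Qed.

(** By induction on n, for all directions i at once: unless i is the first
coordinate, which is the outermost one in the definition of the measure, the
sections at a fixed first coordinate satisfy the same hypothesis; if it is, the
measure is the integral over the other coordinates of the lengths of the
slices. *)
Lemma borel_lebesgue_le_lines n (i : 'I_n) (E : set (n.-tuple bR)) (M : R) :
  measurable E -> E `<=` cube R n ->
  (forall x : n.-tuple R, leb [set y | E (set_coord x i y)] <= M%:E)%E ->
  (borel_lebesgue R n E <= (2 ^+ n * M)%:E)%E.
Proof.
move=> mE Ecube EM.
have M0 : 0 <= M by rewrite -lee_fin; apply: le_trans (EM [tuple 0 | _ < n]).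
elim: n => [[]//|n IHn] in i E mE Ecube EM *.
case: (unliftP ord0 i) EM => [j ->|->] EM.
  rewrite exprSr mulrAC; apply: borel_lebesgue_le_sections => // y.
  apply: (IHn j) => [|u /Ecube /cube_tcons[]//|x].
    exact: measurable_tcons_section.
  rewrite (eq_set (Q := fun z =>
    E (set_coord (tcons (y, x)) (lift ord0 j) z))) // => z.
  by rewrite set_coord_tconsS.
rewrite borel_lebesgueS_rev // mulrC exprSr.
apply: (@le_trans _ _ (M%:E * borel_lebesgue R n (cube R n))%E); last first.
  rewrite EFinM; apply: lee_wpmul2l; first by rewrite lee_fin.
  apply: (le_trans (borel_lebesgue_cube_le n)).
  by rewrite lee_fin ler_peMr ?exprn_ge0 ?ler1n.
apply: integral_le_cst_on.
- exact: measurable_cube.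
- rewrite (_ : (fun u => _) = leb \o ysection (@tcons R n @^-1` E)).
    apply: (measurable_fun_ysection leb).
    exact: measurable_tcons_preimage.
  by apply/funext => u /=; rewrite ysection_tcons.
- by [].
- move=> u uN; rewrite (_ : [set _ | _] = set0) ?measure0 //.
  by apply/seteqP; split=> // y /Ecube /cube_tcons[_ /uN].
- move=> u.
  rewrite (eq_set (Q := fun y => E (set_coord (tcons (0, u)) ord0 y))) // => y.
  rewrite set_coord_tcons0; congr (E (tcons (_, _))); exact: val_inj.
Qed.

End slice.

(** * Sublevel sets of multivariate polynomials *)

Lemma measurable_lt_set d (T : measurableType d) (R : realType) (D : set T)
    (f g : T -> R) :
  measurable D -> measurable_fun setT f -> measurable_fun setT g ->
  measurable [set x | D x /\ f x < g x].
Proof.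
move=> mD mf mg.
rewrite (_ : [set x | _] = D `&` (fun x => f x < g x) @^-1` [set true]) //.
apply: measurableI => //; rewrite -[X in measurable X]setTI.
exact: measurable_fun_ltr.
Qed.

Section sublevel.
Context (R : realType) (n : nat) (p : mpoly n R).
Context (alpha : multinom n) (s : {perm 'I_n}).
Local Notation bR := (measurableTypeR R).
Hypothesis alpha_neq0 : mcoeff alpha p != 0.

Definition agree (j : nat) (m : multinom n) : bool :=
  [forall k : 'I_n, (k < j)%N ==> (m (s k) == alpha (s k))].

(** The coefficient of the product over k < j of x_{s k} ^ alpha_{s k} in p,
seen as a polynomial in these variables. It depends on the other variables
only, but is kept as a function of all of x so that the dimension does not
change when a variable is eliminated. *)
Definition partial_lead (j : nat) (x : n.-tuple R) : R :=
  \sum_(m <- msupp p | agree j m)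
    mcoeff m p * \prod_(k < n | (j <= k)%N) tnth x (s k) ^+ m (s k).

Definition tail_degree (j : nat) : nat := (\sum_(k < n | j <= k) alpha (s k))%N.

Lemma agreeS (j : 'I_n) m :
  agree j.+1 m = agree j m && (m (s j) == alpha (s j)).
Proof.
apply/forallP/andP => [mP|[/forallP mP /eqP mj] k].
  split; last by have := mP j; rewrite leqnn.
  apply/forallP => k; apply/implyP => kj; apply: (implyP (mP k)).
  exact: ltnW.
apply/implyP; rewrite ltnS leq_eqVlt => /orP[/eqP/val_inj->|]; first exact/eqP.
exact/implyP.
Qed.

Lemma agree_all m : agree n m = (m == alpha).
Proof.
apply/forallP/eqP => [mP|-> k]; last by rewrite eqxx implybT.
apply/mnmP => i; have /implyP/(_ (ltn_ord _))/eqP := mP (s^-1%g i).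
by rewrite permKV.
Qed.

Lemma partial_lead0 x : partial_lead 0 x = meval (tnth x) p.
Proof.
rewrite mevalE /partial_lead; apply: eq_big => [m|m _].
  by apply/forallP.
congr (_ * _); rewrite [RHS](reindex_inj (@perm_inj _ s)).
exact: eq_bigl.
Qed.

Lemma partial_lead_last x : partial_lead n x = mcoeff alpha p.
Proof.
rewrite /partial_lead (eq_bigl _ _ agree_all).
under eq_bigr => m _.
  rewrite big_pred0; last by move=> k; rewrite leqNgt ltn_ord.
  over.
rewrite big_mkcond (bigD1_seq alpha) ?msupp_uniq ?mcoeff_msupp //= eqxx mulr1.
by rewrite big1 ?addr0 // => m /negbTE->.
Qed.

Lemma tail_degree0 : tail_degree 0 = mdeg alpha.
Proof. by rewrite mdegE [RHS](reindex_inj (@perm_inj _ s)). Qed.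

Lemma tail_degree_last : tail_degree n = 0%N.
Proof. by rewrite /tail_degree big_pred0 // => k; rewrite leqNgt ltn_ord. Qed.

Lemma geqSE (j k : 'I_n) : (j <= k)%N && (k != j) = (j < k)%N.
Proof. by rewrite ltn_neqAle eq_sym andbC. Qed.

Lemma tail_degreeS (j : 'I_n) :
  tail_degree j = (tail_degree j.+1 + alpha (s j))%N.
Proof.
rewrite /tail_degree (bigD1 j) //= addnC; congr (_ + _)%N.
by apply: eq_bigl => k; rewrite geqSE.
Qed.

Lemma measurable_partial_lead j :
  measurable_fun setT (partial_lead j : n.-tuple bR -> bR).
Proof.
rewrite (_ : partial_lead j = fun x => \sum_(m <- msupp p)
    if agree j m then mcoeff m p *
      \prod_(k < n) if (j <= k)%N then tnth x (s k) ^+ m (s k) else 1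
    else 0).
  apply: measurable_sum => m; case: (agree j m) => //.
  apply: measurable_funM => //; apply: measurable_prod => k _.
  case: (j <= k)%N => //.
  apply: measurable_funX; exact: measurable_tnth.
apply/funext => x; rewrite /partial_lead big_mkcond.
apply: eq_bigr => m _.
by rewrite [in LHS]big_mkcond.
Qed.

Hypothesis alpha_max : forall m, m != alpha -> mcoeff m p != 0 ->
  exists j : 'I_n, (m (s j) < alpha (s j))%N /\
    forall k : 'I_n, (k < j)%N -> alpha (s k) = m (s k).

(** Where m and alpha first differ, alpha is larger; this happens at s j or
later. *)
Lemma agree_leq (j : 'I_n) m :
  mcoeff m p != 0 -> agree j m -> (m (s j) <= alpha (s j))%N.
Proof.
move=> pm /forallP mj; have [->//|ma] := eqVneq m alpha.
have [i [mi mlt]] := alpha_max ma pm.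
case: (ltngtP i j) => [ij|ji|/val_inj <-]; [|by rewrite mlt|exact: ltnW].
by move: mi; rewrite (eqP (implyP (mj i) ij)) ltnn.
Qed.

(** The restriction of partial_lead j to the line through x in the direction
s j, as a univariate polynomial. *)
Definition line_poly (j : 'I_n) (x : n.-tuple R) : {poly R} :=
  \sum_(m <- msupp p | agree j m)
    (mcoeff m p * \prod_(k < n | (j < k)%N) tnth x (s k) ^+ m (s k))
      *: 'X^(m (s j)).

Lemma line_polyE (j : 'I_n) x y :
  partial_lead j (set_coord x (s j) y) = (line_poly j x).[y].
Proof.
rewrite /line_poly horner_sum; apply: eq_bigr => m _.
rewrite hornerZ hornerXn (bigD1 j) //= tnth_mktuple eqxx.
rewrite -mulrA [_ ^+ _ * _ in LHS]mulrC; congr (_ * (_ * _)).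
apply: eq_big => [k|k /andP[_ kj]]; first by rewrite geqSE.
by rewrite tnth_mktuple (inj_eq (@perm_inj _ s)) (negbTE kj).
Qed.

Lemma coef_line_poly (j : 'I_n) x :
  (line_poly j x)`_(alpha (s j)) = partial_lead j.+1 x.
Proof.
rewrite /line_poly coef_sum /partial_lead (eq_bigl _ _ (agreeS j)) big_mkcondr.
apply: eq_bigr => m _; rewrite coefZ coefXn eq_sym.
by case: eqP => _; rewrite ?mulr1 ?mulr0.
Qed.

Lemma size_line_poly (j : 'I_n) x :
  (size (line_poly j x) <= (alpha (s j)).+1)%N.
Proof.
rewrite /line_poly big_seq_cond; apply: (leq_trans (size_sum _ _ _)).
apply/bigmax_leqP_seq => m _ /andP[mp mj].
apply: (leq_trans (size_scale_leq _ _)).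
by rewrite size_polyXn ltnS agree_leq // -mcoeff_msupp.
Qed.

Lemma partial_lead_set_coord (j : 'I_n) x y :
  partial_lead j.+1 (set_coord x (s j) y) = partial_lead j.+1 x.
Proof.
apply: eq_bigr => m _; congr (_ * _); apply: eq_bigr => k jk.
by rewrite tnth_mktuple (inj_eq (@perm_inj _ s)) -val_eqE gtn_eqF.
Qed.

Lemma measurable_partial_sublevel j (f : n.-tuple bR -> R) :
  measurable_fun setT f ->
  measurable ([set x | cube R n x /\ `|partial_lead j x| < f x]
    : set (n.-tuple bR)).
Proof.
move=> mf; apply: measurable_lt_set => //; first exact: measurable_cube.
apply: measurableT_comp => //; exact: measurable_partial_lead.
Qed.

Lemma measurable_norm_partial_leadM j c :
  measurable_fun setT (fun x : n.-tuple bR => `|partial_lead j x| * c).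
Proof.
apply: measurable_funM => //; apply: measurableT_comp => //.
exact: measurable_partial_lead.
Qed.

(** On each line in the direction s j the polynomial q_j has the leading
coefficient q_{j+1}, constant along the line, and degree alpha_{s j}. The lines
on which q_{j+1} vanishes miss the set, since |q_j| < 0 is impossible. *)
Lemma sublevel_step (j : 'I_n) (t : R) : 0 < t ->
  (borel_lebesgue R n [set x | cube R n x /\
     (`|partial_lead j x| < `|partial_lead j.+1 x| * t ^+ alpha (s j))%R] <=
   (2 ^+ n * ((alpha (s j) * 2)%:R * t))%:E)%E.
Proof.
move=> t0.
set E := [set x | _].
have mE : measurable (E : set (n.-tuple bR)).
  by apply: measurable_partial_sublevel; apply: measurable_norm_partial_leadM.
have E_cube : E `<=` cube R n by move=> x [].
apply: (borel_lebesgue_le_lines (i := s j) mE E_cube) => x.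
have mS : measurable [set y : bR | E (set_coord x (s j) y)].
  rewrite -[X in measurable X]setTI; exact: measurable_set_coord.
have [q0|q0] := eqVneq (partial_lead j.+1 x) 0.
  rewrite (_ : [set y | _] = set0) ?measure0 ?lee_fin ?mulr_ge0 ?(ltW t0) //.
  apply/seteqP; split=> // y [_].
  by rewrite partial_lead_set_coord q0 normr0 mul0r ltNge normr_ge0.
have szP : size (line_poly j x) = (alpha (s j)).+1.
  apply/eqP; rewrite eqn_leq size_line_poly ltnNge; apply/negP => sz.
  by move/eqP: q0; rewrite -coef_line_poly; apply; exact: (leq_sizeP _ _ sz).
have := @lebesgue_sublevel_poly_le R (line_poly j x) t _ mS t0.
rewrite szP; apply => y [_] /=.
by rewrite line_polyE partial_lead_set_coord lead_coefE szP coef_line_poly.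
Qed.

(** Descending induction on j = n - i, from the constant q_n = p_alpha. *)
Lemma sublevel_partial_lead (i : nat) : (i <= n)%N ->
  exists2 A : R, 0 <= A & forall t, 0 < t ->
  (borel_lebesgue R n [set x | cube R n x /\
     (`|partial_lead (n - i) x| <
       `|mcoeff alpha p| * t ^+ tail_degree (n - i))%R] <=
   (A * t)%:E)%E.
Proof.
elim: i => [|i IHi] i_n.
  exists 0 => // t _; rewrite subn0 tail_degree_last mul0r.
  rewrite (_ : [set x | _] = set0) ?measure0 //.
  apply/seteqP; split=> // x [_].
  by rewrite partial_lead_last expr0 mulr1 ltxx.
have [A A0 IH] := IHi (ltnW i_n).
have jn : (n - i.+1 < n)%N by rewrite ltn_subrL; case: (n) i_n.
pose j := Ordinal jn.
have jE : (n - i)%N = j.+1 by rewrite /= subnSK.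
exists (A + 2 ^+ n * (alpha (s j) * 2)%:R) => [|t t0].
  by rewrite addr_ge0 ?mulr_ge0.
rewrite mulrDl -mulrA EFinD.
have := leeD (IH t t0) (sublevel_step j t0).
rewrite jE; apply: le_trans.
have mS1 := @measurable_partial_sublevel j.+1 _
  (measurable_cst (`|mcoeff alpha p| * t ^+ tail_degree j.+1)).
have mS2 := @measurable_partial_sublevel j _
  (measurable_norm_partial_leadM j.+1 (t ^+ alpha (s j))).
apply: (le_trans _ (@measureU2 _ _ R (borel_lebesgue R n) _ _ mS1 mS2)).
apply: le_measure; rewrite ?inE.
- exact: measurable_partial_sublevel.
- exact: measurableU.
- move=> x [xcube xlt] /=.
  have [q1|q1] := ltP `|partial_lead j.+1 x|
    (`|mcoeff alpha p| * t ^+ tail_degree j.+1); first by left.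
  right; split => //; apply: lt_le_trans xlt _.
  by rewrite (tail_degreeS j) exprD mulrA ler_wpM2r // exprn_ge0 // ltW.
Qed.

Lemma sublevel_meval : exists2 A : R, 0 <= A & forall t, 0 < t ->
  (borel_lebesgue R n [set x | cube R n x /\
     (`|meval (tnth x) p| < `|mcoeff alpha p| * t ^+ mdeg alpha)%R] <=
   (A * t)%:E)%E.
Proof.
have [A A0 AP] := sublevel_partial_lead (leqnn n).
exists A => // t /AP; rewrite subnn tail_degree0.
by under eq_set do rewrite partial_lead0.
Qed.

End sublevel.

(** * Norms on finite-dimensional spaces *)

Section norms.
Context (R : realType).

Section norm_theory.
Context (V : lmodType R) (N : V -> R) (HN : is_norm N).

Lemma is_norm_0 : N 0 = 0.
Proof. by rewrite -(scale0r 0) (is_normZ HN) normr0 mul0r. Qed.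

Lemma is_normN u : N (- u) = N u.
Proof. by rewrite -scaleN1r (is_normZ HN) normrN1 mul1r. Qed.

Lemma is_norm_ge0 u : 0 <= N u.
Proof.
have := is_norm_triangle HN u (- u).
by rewrite subrr is_norm_0 is_normN -mulr2n pmulrn_lge0.
Qed.

Lemma is_norm_dist u v : `|N u - N v| <= N (u - v).
Proof.
have Nsub a b : N a - N b <= N (a - b).
  by rewrite lerBlDr; apply: le_trans (is_norm_triangle HN _ _); rewrite subrK.
by rewrite ler_norml Nsub andbT lerNl opprB -(is_normN (u - v)) opprB Nsub.
Qed.

Lemma is_norm_sum (I : Type) (r : seq I) (F : I -> V) :
  N (\sum_(i <- r) F i) <= \sum_(i <- r) N (F i).
Proof.
elim/big_ind2: _ => [|u a v b ua vb|//]; first by rewrite is_norm_0.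
by apply: le_trans (is_norm_triangle HN _ _) _; exact: lerD.
Qed.

End norm_theory.

(** N is continuous for the maximum norm, so it has a minimum on the compact
unit sphere of that norm, and the minimum is positive. For m = 0 the sphere is
empty and the only vector is 0. *)
Lemma mx_norm_le_is_norm m (N : 'rV[R]_m -> R) : is_norm N ->
  exists2 c : R, 0 <= c & forall v, `|v| <= c * N v.
Proof.
move=> HN.
pose K := \sum_i N (delta_mx 0 i).
have K0 : 0 <= K by apply: sumr_ge0 => i _; exact: is_norm_ge0.
have NK v : N v <= `|v| * K.
  rewrite {1}[v]row_sum_delta mulr_sumr; apply: le_trans (is_norm_sum HN _ _) _.
  apply: ler_sum => i _; rewrite (is_normZ HN) ler_wpM2r ?is_norm_ge0//.
  rewrite [leRHS]/Num.norm /= mx_normrE.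
  exact: (le_bigmax _ (fun ij => `|v ij.1 ij.2|) (0, i)).
have Ncont : continuous N.
  move=> u A /nbhs_ballP[e /= e0 eA]; apply/nbhs_ballP.
  have d0 : 0 < e / (K + 1) by rewrite divr_gt0 // ltr_wpDl.
  exists (e / (K + 1)) => // v uv; apply: eA.
  move: uv; rewrite mx_norm_ball /ball_ /= => uv.
  apply: le_lt_trans (is_norm_dist HN _ _) _; apply: le_lt_trans (NK _) _.
  apply: (@le_lt_trans _ _ (`|u - v| * (K + 1))).
    by rewrite ler_wpM2l // lerDl.
  by rewrite -ltr_pdivlMr // ltr_wpDl.
pose S := [set v : 'rV[R]_m | `|v| = 1].
have Scompact : compact S.
  apply: bounded_closed_compact.
    exists 1; split=> // M M1 v vS; apply: le_trans (ltW M1).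
    by rewrite le_eqVlt; apply/orP; left; apply/eqP; exact: vS.
  have /continuous_closedP := @norm_continuous R 'rV[R]_m.
  by move=> /(_ [set x | x = 1] (@closed_eq _ _)).
have [[u Su]|S0] := pselect (S !=set0); last first.
  exists 0 => // v; rewrite mul0r.
  have [->|v0] := eqVneq v 0; first by rewrite normr0.
  exfalso; apply: S0; exists (`|v|^-1 *: v).
  by rewrite /S /= normrZ normfV normr_id mulVf // normr_eq0.
have [||c cS cmin] := @EVT_min_rV R m N S _ Scompact; first by exists u.
  exact: continuous_subspaceT.
have c0 : 0 < N c.
  rewrite lt_neqAle is_norm_ge0 // andbT eq_sym.
  apply/eqP => /(is_norm0_eq0 HN) c0.
  by move: cS; rewrite inE c0 /S /= normr0 => /eqP; rewrite eq_sym oner_eq0.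
exists (N c)^-1 => [|v]; first by rewrite invr_ge0 ltW.
have [->|v0] := eqVneq v 0; first by rewrite normr0 is_norm_0 // mulr0.
have vS : `|v|^-1 *: v \in S.
  by rewrite inE /S /= normrZ normfV normr_id mulVf // normr_eq0.
have := cmin _ vS; rewrite (is_normZ HN) normfV normr_id.
by rewrite ler_pdivlMl ?normr_gt0 // ler_pdivlMl // mulrC.
Qed.

Lemma coord_le_is_norm (T : finType) (N : {ffun T -> R^o} -> R) : is_norm N ->
  exists2 c : R, 0 <= c & forall (v : {ffun T -> R^o}) b, `|v b| <= c * N v.
Proof.
move=> HN.
pose f (v : 'rV[R]_#|T|) : {ffun T -> R^o} := [ffun b => v 0 (enum_rank b)].
have HNf : is_norm (N \o f).
  split=> [u v|a u|u] /=.
  - rewrite (_ : f (u + v) = f u + f v); first exact: is_norm_triangle HN _ _.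
    by apply/ffunP => b; rewrite !ffunE mxE.
  - rewrite (_ : f (a *: u) = a *: f u); first exact: is_normZ HN _ _.
    by apply/ffunP => b; rewrite !ffunE mxE.
  - move=> /(is_norm0_eq0 HN)/ffunP fu0; apply/rowP => i.
    by have := fu0 (enum_val i); rewrite !ffunE enum_valK mxE.
have [c c0 cP] := mx_norm_le_is_norm HNf.
exists c => // v b; have := cP (\row_i v (enum_val i)).
rewrite /= (_ : f _ = v); last by apply/ffunP => d; rewrite !ffunE mxE enum_rankK.
apply: le_trans; rewrite [leRHS]/Num.norm /= mx_normrE.
have := le_bigmax 0 (fun ij => `|(\row_i v (enum_val i)) ij.1 ij.2|)
  (0, enum_rank b).
by rewrite /= mxE enum_rankK.
Qed.

End norms.


(** * Integrals of bounded functions *)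

Section bounded_measurable.
Context d (T : measurableType d) (R : realType).
Context (mu : {measure set T -> \bar R}) (D : set T).
Hypotheses (mD : measurable D) (Dfin : (mu D < +oo)%E).
Implicit Types f g : T -> R.

Definition bounded_measurable f :=
  measurable_fun D f /\ exists M, forall x, D x -> `|f x| <= M.

Lemma bounded_measurable_cst c : bounded_measurable (fun=> c).
Proof. by split=> //; exists `|c|. Qed.

Lemma bounded_measurableD f g : bounded_measurable f -> bounded_measurable g ->
  bounded_measurable (fun x => f x + g x).
Proof.
move=> [mf [M fM]] [mg [L gL]]; split; first exact: measurable_funD.
by exists (M + L) => x Dx; apply: le_trans (ler_normD _ _) (lerD (fM x Dx) (gL x Dx)).
Qed.

Lemma bounded_measurableM f g : bounded_measurable f -> bounded_measurable g ->
  bounded_measurable (fun x => f x * g x).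
Proof.
move=> [mf [M fM]] [mg [L gL]]; split; first exact: measurable_funM.
by exists (M * L) => x Dx; rewrite normrM ler_pM ?fM ?gL.
Qed.

Lemma bounded_measurableB f g : bounded_measurable f -> bounded_measurable g ->
  bounded_measurable (fun x => f x - g x).
Proof.
move=> bf bg; under eq_fun do rewrite -mulN1r.
exact/bounded_measurableD/bounded_measurableM/bg/bounded_measurable_cst.
Qed.

Lemma bounded_measurable_norm f :
  bounded_measurable f -> bounded_measurable (fun x => `|f x|).
Proof.
move=> [mf [M fM]]; split; first exact: measurableT_comp.
by exists M => x Dx; rewrite normr_id fM.
Qed.

Lemma bounded_measurable_sum (I : Type) (r : seq I) (F : I -> T -> R) :
  (forall i, bounded_measurable (F i)) ->
  bounded_measurable (fun x => \sum_(i <- r) F i x).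
Proof.
move=> bF; elim: r => [|i r IHr].
  by under eq_fun do rewrite big_nil; exact: bounded_measurable_cst.
by under eq_fun do rewrite big_cons; exact: bounded_measurableD.
Qed.

Lemma bounded_measurable_integrable f :
  bounded_measurable f -> mu.-integrable D (EFin \o f).
Proof.
move=> [mf [M fM]]; apply: measurable_bounded_integrable => //.
exists M; split=> [|L ML x Dx]; first exact: num_real.
by apply: le_trans (ltW ML); exact: fM.
Qed.

Lemma Rintegral_sum (I : Type) (r : seq I) (F : I -> T -> R) :
  (forall i, bounded_measurable (F i)) ->
  \int[mu]_(x in D) (\sum_(i <- r) F i x) =
  \sum_(i <- r) \int[mu]_(x in D) F i x.
Proof.
move=> bF; elim: r => [|i r IHr].
  under eq_Rintegral do rewrite big_nil.
  by rewrite big_nil Rintegral_cst // mul0r.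
under eq_Rintegral do rewrite big_cons.
rewrite big_cons RintegralD ?IHr //; apply: bounded_measurable_integrable => //.
exact: bounded_measurable_sum.
Qed.

(** Markov's inequality, integrated from c |f| <= |q| |f| + c 1_{|q| < c}, which
holds because |f| <= 1. *)
Lemma layer_le_Rintegral (q f : T -> R) (c : R) :
  0 <= c -> bounded_measurable q -> bounded_measurable f ->
  (forall x, D x -> `|f x| <= 1) ->
  (forall x, D x -> q x * f x = `|q x| * `|f x|) ->
  c * (\int[mu]_(x in D) `|f x| - fine (mu [set x | D x /\ `|q x| < c])) <=
  \int[mu]_(x in D) (q x * f x).
Proof.
move=> c0 bq bf f1 qf.
set E := [set x | _].
have mE : measurable E.
  rewrite (_ : E = D `&` (fun x => `|q x| < c) @^-1` [set true]) //.
  by apply: measurable_fun_ltr => //; apply: measurableT_comp => //; case: bq.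
have DE : D `&` E = E by apply/setIidr => x [].
have bE : bounded_measurable (\1_E : T -> R).
  split; first exact: measurable_indic.
  by exists 1 => x _; rewrite indicE; case: (_ \in _); rewrite ?normr1 ?normr0.
have <- : \int[mu]_(x in D) (\1_E x : R) = fine (mu E).
  by rewrite /Rintegral integral_indic // setIC DE.
rewrite -RintegralB //; try exact: bounded_measurable_integrable;
  last exact/bounded_measurable_integrable/bounded_measurable_norm.
rewrite -RintegralZl //; last first.
  apply: bounded_measurable_integrable.
  exact/bounded_measurableB/bE/bounded_measurable_norm.
apply: le_Rintegral => //.
- apply: bounded_measurable_integrable; apply: bounded_measurableM.
    exact: bounded_measurable_cst.
  exact/bounded_measurableB/bE/bounded_measurable_norm.
- exact/bounded_measurable_integrable/bounded_measurableM.
move=> x Dx; rewrite qf // indicE.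
case: (boolP (x \in E)) => [|/negP xE] /=.
  move=> _; apply: (@le_trans _ _ 0); last exact: mulr_ge0.
  by rewrite mulr_ge0_le0 // subr_le0 f1.
rewrite subr0 ler_wpM2r // leNgt; apply/negP => qc; apply: xE.
by rewrite inE.
Qed.

End bounded_measurable.

(** * Moments of functions on the cube *)

Section lebesgue_cube.
Context (R : realType) (n : nat).
Local Notation bR := (measurableTypeR R).

Lemma measurable_borel_lebesgue (A : set (n.-tuple bR)) :
  measurable A -> measurable (A : set (lebesgue_type R n)).
Proof. exact: caratheodory_measurable_mu_ext. Qed.

Lemma lebesgueE (A : set (n.-tuple bR)) :
  measurable A -> lebesgue R n A = borel_lebesgue R n A.
Proof. exact: measurable_mu_extE. Qed.

Lemma measurable_fun_lebesgue (f : n.-tuple bR -> bR) :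
  measurable_fun setT f -> measurable_fun setT (f : lebesgue_type R n -> R).
Proof.
by move=> mf _ Y mY; apply: measurable_borel_lebesgue; exact: mf.
Qed.

Lemma measurable_monomial b :
  measurable_fun setT (@monomial R n b : n.-tuple bR -> bR).
Proof.
apply: measurable_prod => i _; apply: measurable_funX; exact: measurable_tnth.
Qed.

Lemma measurable_lebesgue_cube :
  measurable (cube R n : set (lebesgue_type R n)).
Proof. by apply: measurable_borel_lebesgue; exact: measurable_cube. Qed.

Lemma lebesgue_cube_fin : (lebesgue R n (cube R n) < +oo)%E.
Proof.
rewrite lebesgueE; last exact: measurable_cube.
exact: le_lt_trans (borel_lebesgue_cube_le R n) (ltry _).
Qed.

Lemma bounded_monomial b :
  bounded_measurable (cube R n : set (lebesgue_type R n)) (@monomial R n b).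
Proof.
split.
  apply: measurable_funTS; apply: measurable_fun_lebesgue.
  exact: measurable_monomial.
exists 1 => x xD; rewrite normr_prod; apply: prodr_ile1 => i _.
by rewrite normr_ge0 normrX exprn_ile1 // ler_norml.
Qed.

End lebesgue_cube.

Section polynomial.
Context (R : realType) (n : nat) (p : mpoly n R).
Local Notation bR := (measurableTypeR R).
Local Notation leb := (lebesgue R n).
Local Notation D := (cube R n : set (lebesgue_type R n)).

Lemma meval_sum_monomial d (x : n.-tuple R) :
  (forall b, mcoeff b p != 0 -> (mdeg b <= d)%N) ->
  meval (tnth x) p = \sum_(b : bmultinom n d.+1) mcoeff b p * monomial b x.
Proof.
move=> p_d; rewrite /meval (@mmapE n R R (tnth x) idfun p d.+1) //.
by apply/bigmax_leqP_seq => b; rewrite mcoeff_msupp => /p_d.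
Qed.

Lemma measurable_meval :
  measurable_fun setT (fun x : n.-tuple bR => meval (tnth x) p : bR).
Proof.
rewrite (_ : (fun _ => _) = fun x : n.-tuple bR =>
    \sum_(b <- msupp p) (mcoeff b p * monomial b x)); last first.
  by apply/funext => x; rewrite mevalE.
apply: measurable_sum => b; apply: measurable_funM => //.
exact: measurable_monomial.
Qed.

Lemma bounded_meval : bounded_measurable D (fun x => meval (tnth x) p).
Proof.
rewrite (_ : (fun _ => _) = fun x : lebesgue_type R n =>
    \sum_(b <- msupp p) (mcoeff b p * monomial b x)); last first.
  by apply/funext => x; rewrite mevalE.
apply: bounded_measurable_sum => b.
apply: (bounded_measurableM _ (bounded_monomial R b)).
exact: bounded_measurable_cst.
Qed.

Lemma bounded_nonneg_indicator : bounded_measurable D (nonneg_indicator p).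
Proof.
rewrite /nonneg_indicator; split; last first.
  exists 1 => x _; rewrite indicE.
  by case: (_ \in _); rewrite ?normr1 ?normr0.
apply: measurable_funTS; apply: measurable_indic.
apply: measurable_borel_lebesgue.
rewrite (_ : [set x | _] = cube R n `&`
  (fun x : n.-tuple bR => 0 <= meval (tnth x) p) @^-1` [set true]) //.
apply: measurableI; first exact: measurable_cube.
rewrite -[X in measurable X]setTI; apply: measurable_fun_ler => //.
exact: measurable_meval.
Qed.

Lemma sign_nonneg_indicatorB (g : n.-tuple R -> R) x :
  cube R n x -> 0 <= g x <= 1 ->
  meval (tnth x) p * (nonneg_indicator p x - g x) =
  `|meval (tnth x) p| * `|nonneg_indicator p x - g x|.
Proof.
move=> xD /andP[g0 g1]; rewrite /nonneg_indicator indicE.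
have [p0|p0] := lerP 0 (meval (tnth x) p).
  rewrite mem_set //= [X in _ = X * _]ger0_norm //.
  by rewrite [X in _ = _ * X]ger0_norm ?subr_ge0.
rewrite memNset => [|[_]]; last by rewrite leNgt p0.
rewrite /= sub0r normrN [X in _ = X * _]ltr0_norm //.
by rewrite [X in _ = _ * X]ger0_norm // mulrN mulNr.
Qed.

Lemma norm_nonneg_indicatorB_le1 (g : n.-tuple R -> R) x :
  0 <= g x <= 1 -> `|nonneg_indicator p x - g x| <= 1.
Proof.
rewrite /nonneg_indicator indicE => /andP[g0 g1]; rewrite ler_norml.
by case: (x \in _) => /=; lra.
Qed.

Lemma Rintegral_meval_mul d (f g : n.-tuple R -> R) :
  (forall b, mcoeff b p != 0 -> (mdeg b <= d)%N) ->
  bounded_measurable D f -> bounded_measurable D g ->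
  \int[leb]_(x in D) (meval (tnth x) p * (f x - g x)) =
  \sum_(b : bmultinom n d.+1) mcoeff b p * (moments d f - moments d g) b.
Proof.
move=> p_d bf bg.
have mD : measurable D by exact: measurable_lebesgue_cube.
have Dfin := lebesgue_cube_fin R n.
have bfg := bounded_measurableB bf bg.
under eq_Rintegral do rewrite (meval_sum_monomial _ p_d) mulr_suml.
rewrite Rintegral_sum // => [|b]; last first.
  apply: (bounded_measurableM _ bfg).
  apply: (bounded_measurableM _ (bounded_monomial R b)).
  exact: bounded_measurable_cst.
apply: eq_bigr => b _; rewrite !ffunE /moment -RintegralB //; last 2 first.
  exact/bounded_measurable_integrable/bounded_measurableM/bf/bounded_monomial.
  exact/bounded_measurable_integrable/bounded_measurableM/bg/bounded_monomial.
rewrite -RintegralZl //; last first.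
  apply: bounded_measurable_integrable => //.
  apply: bounded_measurableB; apply: bounded_measurableM => //.
    exact: bounded_monomial.
  exact: bounded_monomial.
by apply: eq_Rintegral => x _; rewrite -mulrA mulrBr.
Qed.

End polynomial.

(** * The stability estimate *)

Lemma le_powR_of_exprS_le (R : realType) (a : nat) (F B Nv : R) :
  0 <= F -> 0 <= B -> 0 <= Nv -> F ^+ a.+1 <= B * Nv ->
  F <= B `^ (a.+1%:R^-1) * Nv `^ (a.+1%:R^-1).
Proof.
move=> F0 B0 N0 FBN; rewrite -powRM //.
have -> : F = (F ^+ a.+1) `^ a.+1%:R^-1.
  by rewrite -powR_mulrn // -powRrM divff ?powRr1 // pnatr_eq0.
by rewrite ge0_ler_powR // ?invr_ge0 ?nnegrE ?exprn_ge0 ?mulr_ge0.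
Qed.

Theorem mainTheorem2 (R : realType) (n : nat) (n_ge1 : (1 <= n)%N) :
  exists C : R, 0 < C /\
  forall (d : nat) (p : mpoly n R) (alpha : multinom n)
    (N : {ffun bmultinom n d.+1 -> R^o} -> R),
  (1 <= d)%N ->
  (forall beta : multinom n, mcoeff beta p != 0 -> (mdeg beta <= d)%N) ->
  ~ (exists c : R, p = mpolyC n c) ->
  admissible alpha p ->
  is_norm N ->
  let chi := nonneg_indicator p in
  exists K : R, forall g : n.-tuple R -> R,
  measurable_fun (cube R n : set (lebesgue_type R n))
    (g : lebesgue_type R n -> R) ->
  (forall x, cube R n x -> 0 <= g x <= 1) ->
  l1norm (fun x => chi x - g x) <=
    (`|mcoeff alpha p| `^ (mdeg alpha)%:R^-1) / (4 * d%:R) * C ->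
  l1norm (fun x => chi x - g x) <=
    K * (N (moments d chi - moments d g) `^ ((mdeg alpha).+1%:R^-1)).
Proof.
exists 1; split=> // d p alpha N _ p_d _ [alpha0 [s alpha_max]] HN chi.
have [A0 A0_ge0 AP] := sublevel_meval alpha0 alpha_max.
have [kappa kappa0 kappaP] := coord_le_is_norm HN.
(* A0 may vanish, and A is to be a denominator. *)
pose A := A0 + 1; have A_gt0 : 0 < A by rewrite ltr_wpDl.
pose L := \sum_(b : bmultinom n d.+1) `|mcoeff b p| * kappa.
have L0 : 0 <= L by apply: sumr_ge0 => b _; rewrite mulr_ge0.
pose c := `|mcoeff alpha p|; have c0 : 0 < c by rewrite normr_gt0.
pose a := mdeg alpha.
pose B := 2 * (2 * A) ^+ a * L / c.
have B0 : 0 <= B by rewrite divr_ge0 ?mulr_ge0 ?exprn_ge0 ?mulr_ge0 // ltW.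
exists (B `^ a.+1%:R^-1) => g mg g01 _.
have bg : bounded_measurable (cube R n : set (lebesgue_type R n)) g.
  by split=> //; exists 1 => x /g01; rewrite ler_norml; lra.
have bchi := bounded_nonneg_indicator p.
set F := l1norm _; set v := moments d chi - _.
have F0 : 0 <= F by apply: Rintegral_ge0.
have Nv0 : 0 <= N v by exact: is_norm_ge0.
have [->|F_neq0] := eqVneq F 0; first by rewrite mulr_ge0 ?powR_ge0.
have F_gt0 : 0 < F by rewrite lt_neqAle eq_sym F_neq0.
apply: le_powR_of_exprS_le => //.
(* At this t the sublevel set carries at most half of F. *)
pose t := F / (2 * A).
have t0 : 0 < t by rewrite divr_gt0 // mulr_gt0.
have moment_le : \int[lebesgue R n]_(x in cube R n)
    (meval (tnth x) p * (chi x - g x)) <= L * N v.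
  rewrite (Rintegral_meval_mul p_d bchi bg) mulr_suml; apply: ler_sum => b _.
  apply: le_trans (ler_norm _) _.
  by rewrite normrM -mulrA ler_wpM2l // kappaP.
have sublevel_le : fine (lebesgue R n
    [set x | cube R n x /\ `|meval (tnth x) p| < c * t ^+ a]) <= F / 2.
  rewrite lebesgueE; last first.
    apply: measurable_lt_set => //; first exact: measurable_cube.
    by apply: measurableT_comp => //; exact: measurable_meval.
  have AF : A0 * t <= F / 2.
    rewrite (_ : F / 2 = A * t); last by rewrite /t; field; rewrite gt_eqF.
    by rewrite ler_wpM2r ?(ltW t0) // lerDl.
  apply: le_trans AF; rewrite -lee_fin fineK; first exact: AP.
  by rewrite ge0_fin_numE // (le_lt_trans (AP t t0)) // ltry.
have := @layer_le_Rintegral _ _ R (lebesgue R n) (cube R n) _ _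
  (fun x => meval (tnth x) p) (fun x => chi x - g x) (c * t ^+ a).
move=> /(_ (@measurable_lebesgue_cube R n) (lebesgue_cube_fin R n)) layer.
have ct0 : 0 <= c * t ^+ a by rewrite mulr_ge0 ?exprn_ge0 // ltW.
move: layer => /(_ ct0 (bounded_meval p) (bounded_measurableB bchi bg)) layer.
have {layer} : c * t ^+ a * (F / 2) <= L * N v.
  apply: le_trans moment_le; apply: le_trans (layer _ _).
  - rewrite ler_wpM2l // (@le_trans _ _ (F - F / 2)) //; first by lra.
    by rewrite lerD2l lerN2.
  - by move=> x /g01; exact: norm_nonneg_indicatorB_le1.
  - by move=> x xD; apply: sign_nonneg_indicatorB => //; exact: g01.
move=> ctF.
have -> : B * N v = L * N v * (2 * (2 * A) ^+ a / c) by rewrite /B; ring.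
have -> : F ^+ a.+1 = c * t ^+ a * (F / 2) * (2 * (2 * A) ^+ a / c).
  have tA : F = t * (2 * A) by rewrite divfK // gt_eqF // mulr_gt0.
  by rewrite exprSr {1}tA exprMn; field; rewrite gt_eqF.
by rewrite ler_wpM2r // divr_ge0 ?mulr_ge0 ?exprn_ge0 ?mulr_ge0 // ltW.
Qed.
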